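(* For every positive integer $d$ there exists $c=c(d)>0$ such that the following holds for every positive integer $t$. Let $V$ be a set of $n$ points in $\mathbb{R}^{d}$ and let $G$ be a graph on vertex set $V$ such that $G$ contains no matching $\{x^1,y^1\},\dots,\{x^t,y^t\}$ of size $t$ satisfying $\bigcap_{i=1}^t b(x^i,y^i)\neq\emptyset$. Then $e(G)\le c\,t\,n(\log n)^{d-1}$.
   Context: For $x,y\in\mathbb{R}^d$, $b(x,y)=\prod_{i=1}^d[\min(x_i,y_i),\max(x_i,y_i)]$ is the axis-parallel box spanned by $x$ and $y$. A matching is a set of pairwise vertex-disjoint edges. $e(G)$ denotes the number of edges of $G$. *)

(* Defs.v *)
From mathcomp Require Import all_boot all_order all_algebra.
From mathcomp Require Import finmap.
From mathcomp Require Import classical_sets reals exp.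

Set Implicit Arguments.
Unset Strict Implicit.
Unset Printing Implicit Defensive.

Import Order.TTheory GRing.Theory Num.Theory.

Local Open Scope ring_scope.

Definition box (R : realType) (d : nat) (x y : 'rV[R]_d) : set 'rV[R]_d :=
  [set z | forall i : 'I_d,
     Num.min (x 0 i) (y 0 i) <= z 0 i <= Num.max (x 0 i) (y 0 i)]%classic.

(* A simple graph on T is given by its adjacency relation e, assumed
   symmetric and irreflexive where these notions are used. *)
Definition edges (T : finType) (e : rel T) : {set {set T}} :=
  [set A : {set T} | [exists x, exists y, e x y && (A == [set x; y]%SET)]]%SET.

(* The edges {x i, y i}, i < t, form a matching of size t: disjointness for
   i <> j also forces the t edges to be distinct. *)
Definition is_matching (T : finType) (e : rel T) (t : nat)
    (x y : 'I_t -> T) : Prop :=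
  (forall i, [set x i; y i]%SET \in edges e) /\
  (forall i j, i != j -> [disjoint [set x i; y i]%SET & [set x j; y j]%SET]).

(* Main.v *)
(** Order the points along the last coordinate and split them at the median.
    The boxes of the edges between the two halves all meet the median
    hyperplane, so these edges are controlled by the case of dimension
    [d - 1], and the edges inside the halves by recursion: each dimension
    beyond the first costs one logarithmic factor.  In dimension 1 no
    logarithm is lost: if the points have ranks [0, ..., n - 1], then the edges
    whose two end ranks have a given sum [k] are pairwise disjoint and nested
    around the point of rank [k / 2], so there are fewer than [t] of them, and
    there are fewer than [2n] possible sums. *)
Require Import Defs.
From mathcomp Require Import all_boot all_order all_algebra.
From mathcomp Require Import finmap zify ring lra.
From mathcomp Require Import classical_sets reals exp.

Import Order.TTheory GRing.Theory Num.Theory.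

Local Open Scope ring_scope.

(** Sorting breaks ties between equal coordinates: ranks are distinct although the coordinate is
    only weakly monotone in them, which is enough because boxes are closed. *)
Lemma exists_rank (T : finType) (R : realDomainType) (X : T -> R)
    (S : {set T}) :
  exists r : T -> nat,
    [/\ {in S &, injective r},
        {in S, forall u, (r u < #|S|)%N},
        {in S &, forall u v, (r u <= r v)%N -> X u <= X v} &
        forall k, (k < #|S|)%N -> exists2 u, u \in S & r u = k].
Proof.
pose le := relpre X (fun a b : R => a <= b); pose s := sort le (enum S).
have sS u : (u \in s) = (u \in S) by rewrite mem_sort mem_enum.
have sz : size s = #|S| by rewrite size_sort -cardE.
have us : uniq s by rewrite sort_uniq enum_uniq.
have le_tr : transitive le by move=> b a c; apply: le_trans.
have ss : sorted le s by apply: sort_sorted => a b; apply: le_total.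
exists (index^~ s); split.
- move=> u v uS vS /= e; rewrite -(nth_index u (x := u) (s := s)) ?sS //.
  by rewrite e nth_index ?sS.
- by move=> u uS /=; rewrite -sz index_mem sS.
- move=> u v uS vS /= uv.
  have := sorted_leq_nth le_tr (fun a => lexx (X a)) u ss.
  move=> /(_ (index u s) (index v s)); rewrite !inE !index_mem !sS => /(_ uS vS uv).
  by rewrite /le /= !nth_index ?sS.
- rewrite -sz => k ks.
  have [u0 _] : exists u, u \in s by case: (s) ks => [|a l] // _; exists a; rewrite inE eqxx.
  exists (nth u0 s k); first by rewrite -sS mem_nth.
  by rewrite index_uniq.
Qed.

Lemma card_rank_le (T : finType) (A : {set T}) (r : T -> nat) (m h : nat) :
  {in A &, injective r} -> {in A, forall u, (m <= r u < m + h)%N} ->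
  (#|A| <= h)%N.
Proof.
move=> r_inj rA; rewrite cardE -(size_map r) -[leqRHS](size_iota m).
apply: uniq_leq_size.
  by rewrite map_inj_in_uniq ?enum_uniq // => u v; rewrite !mem_enum; apply: r_inj.
by move=> _ /mapP[u + ->]; rewrite mem_enum mem_iota => /rA.
Qed.

(* The vertices sit in [R^d] through the coordinates [X 0, ..., X (d - 1)], and
   edges are oriented pairs.  A product of intervals being a box, a common
   point of the boxes is found coordinate by coordinate. *)
Definition box_matching {T : finType} {R : realDomainType} (X : nat -> T -> R)
    (d : nat) (M : {set T * T}) : Prop :=
  {in M &, forall p q, p != q ->
     [disjoint [set p.1; p.2] & [set q.1; q.2]]%SET} /\
  (forall i, (i < d)%N -> exists z, {in M, forall p,
     Num.min (X i p.1) (X i p.2) <= z <= Num.max (X i p.1) (X i p.2)}).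

Lemma minmax_between (R : realDomainType) (a b z : R) :
  (a <= z <= b) || (b <= z <= a) -> Num.min a b <= z <= Num.max a b.
Proof. by rewrite ge_min le_max => /orP[]/andP[-> ->]; rewrite ?orbT. Qed.

Lemma line_edges_bound (T : finType) (R : realDomainType) (X : nat -> T -> R)
    (t : nat) (S : {set T}) (E : {set T * T}) :
  (forall p, p \in E -> [/\ p.1 \in S, p.2 \in S & (p.2, p.1) \notin E]) ->
  (forall M : {set T * T}, M \subset E -> box_matching X 1 M -> (#|M| <= t)%N) ->
  (#|E| <= 2 * t * #|S|)%N.
Proof.
move=> ES Et; have [r [r_inj r_lt r_le r_onto]] := exists_rank _ _ (X 0%N) S.
pose C (k : 'I_(2 * #|S|)) := [set p in E | (r p.1 + r p.2)%N == k]%SET.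
have EC : E \subset (\bigcup_k C k)%SET.
  apply/fintype.subsetP => p pE; have [p1 p2 _] := ES _ pE.
  have lt_k : (r p.1 + r p.2 < 2 * #|S|)%N by move: (r_lt _ p1) (r_lt _ p2); lia.
  by apply/bigcupP; exists (Ordinal lt_k); rewrite // inE pE /=.
apply: leq_trans (subset_leq_card EC) _.
suff Ct k : (#|C k| <= t)%N.
  apply: leq_trans (_ : \sum_k #|C k| <= _)%N.
    elim/big_ind2: _ => [|m A n B Am Bn|//]; first by rewrite cards0.
    by apply: leq_trans (leq_card_setU _ _).1 (leq_add _ _).
  apply: leq_trans (leq_sum _ (fun k _ => Ct k)) _.
  by rewrite sum_nat_const card_ord; lia.
apply: Et; first by apply/fintype.subsetP => p; rewrite inE => /andP[].
split=> [[u v] [u' v']|i].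
  rewrite !inE /= => /andP[pE /eqP pk] /andP[qE /eqP qk] pq.
  have [/= uS vS vuE] := ES _ pE; have [/= uS' vS' vuE'] := ES _ qE.
  rewrite disjoint_subset; apply/fintype.subsetP => w; rewrite !inE.
  (* Equal rank sums and a shared vertex make the other two ends equal too, so the pairs coincide or
     are reverses of each other; [E] never contains both a pair and its reverse. *)
  case/orP => /eqP-> {w}; apply/negP => /orP[]/eqP e; subst.
  - by have e : v = v' by [apply: r_inj => //; lia]; rewrite e eqxx in pq.
  - by have e : v = u' by [apply: r_inj => //; lia]; rewrite -e pE in vuE'.
  - by have e : u = v' by [apply: r_inj => //; lia]; rewrite -e pE in vuE'.
  - by have e : u = u' by [apply: r_inj => //; lia]; rewrite e eqxx in pq.
rewrite ltnS leqn0 => /eqP->.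
(* Of two ranks with sum [k], one is at most [k./2] and the other at least [k./2]. *)
have [|w wS rw] := r_onto (k./2); first by have := ltn_ord k; lia.
exists (X 0%N w) => -[u v]; rewrite inE /= => /andP[pE /eqP pk].
have [/= uS vS _] := ES _ pE; apply: minmax_between.
have [uv|vu] := leqP (r u) (r v).
  by apply/orP; left; apply/andP; split; apply: r_le => //; lia.
by apply/orP; right; apply/andP; split; apply: r_le => //; lia.
Qed.

(** Induction on [d] and, inside it, on [L], which stands for the binary logarithm of [#|S|]:
    passing to a half lowers [L], passing to the crossing edges lowers [d]. *)
Lemma box_edges_bound (T : finType) (R : realDomainType) (X : nat -> T -> R)
    (t d L : nat) (S : {set T}) (E : {set T * T}) :
  (#|S| <= 2 ^ L)%N ->
  (forall p, p \in E -> [/\ p.1 \in S, p.2 \in S & (p.2, p.1) \notin E]) ->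
  (forall M : {set T * T}, M \subset E -> box_matching X d.+1 M -> (#|M| <= t)%N) ->
  (#|E| <= 2 * t * #|S| * L.+1 ^ d)%N.
Proof.
elim: d L S E => [|d IHd] L S E SL ES Et.
  by rewrite expn0 muln1; apply: line_edges_bound ES Et.
elim: L S E SL ES Et => [|L IHL] S E SL ES Et.
  (* Here [#|S| <= 1], and a pair [(u, u)] would be its own reverse. *)
  rewrite (_ : E = finset.set0) ?cards0 //; apply/setP => -[u v]; rewrite inE.
  apply/negP => uvE; have [/= uS vS /negP[]] := ES _ uvE.
  by have e : v = u := card_le1_eqP SL u v uS vS; move: uvE; rewrite e.
have [SL'|SL'] := leqP #|S| (2 ^ L).
  apply: leq_trans (IHL _ _ SL' ES Et) _.
  by rewrite leq_mul2l leq_exp2r // leqnSn orbT.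
have [r [r_inj r_lt r_le r_onto]] := exists_rank _ _ (X d.+1) S.
(* The cut is at rank [2 ^ L] instead of the exact median: since [#|S| <= 2 ^ L.+1], both sides have
   at most [2 ^ L] points. *)
have [w wS rw] := r_onto _ SL'.
pose H := [set u | (r u < 2 ^ L)%N]%SET.
pose inside (A : {set T}) := [set p in E | (p.1 \in A) && (p.2 \in A)]%SET.
pose cross := [set p in E | (p.1 \in H) != (p.2 \in H)]%SET.
have subE A : inside A \subset E by apply/fintype.subsetP => p; rewrite inE => /andP[].
have crossE : cross \subset E by apply/fintype.subsetP => p; rewrite inE => /andP[].
have cardS := cardsID H S; have expS := expnS 2 L.
have inside_bound (A : {set T}) : A \subset S -> (#|A| <= 2 ^ L)%N ->
    (#|inside A| <= 2 * t * #|A| * L.+1 ^ d.+1)%N.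
  move=> AS AL; apply: IHL => // [p|M MI].
    rewrite inE => /andP[pE /andP[p1 p2]]; split=> //.
    by rewrite inE negb_and; have [_ _ ->] := ES _ pE.
  by apply: Et; apply: fintype.subset_trans MI (subE A).
have low : (#|inside (S :&: H)| <= 2 * t * #|S :&: H| * L.+1 ^ d.+1)%N.
  apply: inside_bound; first exact: subsetIl.
  apply: (card_rank_le _ _ r 0) => [u v|u]; rewrite !inE.
    by move=> /andP[uS _] /andP[vS _]; apply: r_inj.
  by case/andP.
have high : (#|inside (S :\: H)| <= 2 * t * #|S :\: H| * L.+1 ^ d.+1)%N.
  apply: inside_bound; first exact: subsetDl.
  apply: (card_rank_le _ _ r (2 ^ L)) => [u v|u]; rewrite !inE.
    by move=> /andP[_ uS] /andP[_ vS]; apply: r_inj.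
  by move=> /andP[uL uS]; move: (r_lt _ uS); lia.
have mid : (#|cross| <= 2 * t * #|S| * L.+2 ^ d)%N.
  apply: IHd => // [p|M MC [Mdis Mbox]].
    rewrite inE => /andP[pE _]; have [p1 p2 p12] := ES _ pE.
    by split=> //; rewrite inE negb_and p12.
  apply: Et; first exact: fintype.subset_trans MC crossE.
  split=> // i; rewrite ltnS leq_eqVlt => /orP[/eqP->|]; last exact: Mbox.
  (* In the last coordinate the cut point [w] lies between the ends of every crossing pair. *)
  exists (X d.+1 w) => -[u v] /(fintype.subsetP MC); rewrite !inE /= => /andP[pE uv].
  have [/= uS vS _] := ES _ pE; apply: minmax_between.
  have [uL|uL] := ltnP (r u) (2 ^ L); have [vL|vL] := ltnP (r v) (2 ^ L).
  + by rewrite uL vL in uv.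
  + by apply/orP; left; apply/andP; split; apply: r_le => //; lia.
  + by apply/orP; right; apply/andP; split; apply: r_le => //; lia.
  + by rewrite !ltnNge uL vL in uv.
have EU : E \subset (inside (S :&: H) :|: inside (S :\: H) :|: cross)%SET.
  apply/fintype.subsetP => p pE; have [p1 p2 _] := ES _ pE.
  rewrite !inE pE p1 p2 /=.
  by case: (r p.1 < 2 ^ L)%N; case: (r p.2 < 2 ^ L)%N.
apply: leq_trans (subset_leq_card EU) _.
apply: leq_trans (leq_card_setU _ _).1 _.
apply: leq_trans (leq_add (leq_card_setU _ _).1 (leqnn _)) _.
apply: leq_trans (leq_add (leq_add low high) mid) _.
(* What remains is [L.+1 ^ d.+1 + L.+2 ^ d <= L.+2 ^ d.+1], whose right side is
   [L.+1 * L.+2 ^ d + L.+2 ^ d]. *)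
rewrite -mulnDl -mulnDr cardS -mulnDr leq_mul2l; apply/orP; right.
rewrite !expnS [leqRHS]mulSn addnC leq_add2l leq_mul2l.
by case: (d) => [|m]; rewrite ?expn0 ?orbT // leq_exp2r ?leqnSn ?orbT.
Qed.

(** Rounding up gives [up_log 2 n - 1] at most the binary logarithm of [n]; that logarithm is at
    least 1, so the remaining 2 is at most twice it. *)
Lemma up_log_le_ln (R : realType) (n : nat) : (1 < n)%N ->
  (up_log 2 n).+1%:R <= 3 / ln 2 * ln n%:R :> R.
Proof.
move=> n1; have ln2 : 0 < ln 2 :> R by rewrite ln_gt0 // ltr1n.
have ln2n : ln 2 <= ln n%:R :> R.
  by rewrite ler_ln ?posrE ?ltr0n ?ler_nat //; lia.
have [+ _] := andP (up_log_bounds (isT : (1 < 2)%N) n1).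
set L := up_log 2 n => Ln.
have L0 : (0 < L)%N by rewrite up_log_gt0.
have : ((L.-1)%:R * ln 2 <= ln n%:R :> R).
  rewrite mulrC mulr_natr -lnXn ?ltr0n // ler_ln ?posrE ?exprn_gt0 ?ltr0n //.
    by rewrite -natrX ler_nat ltnW.
  by lia.
rewrite mulrAC ler_pdivlMr // => h.
rewrite (_ : L.+1%:R = L.-1%:R + 2 :> R); last by rewrite -natrD; congr (_%:R); lia.
by lra.
Qed.

Theorem theorem11 (R : realType) (d : nat) (hd : (0 < d)%N) :
  exists c : R, 0 < c /\
    forall (t : nat) (ht : (0 < t)%N)
      (V : {fset 'rV[R]_d}) (G : rel V)
      (Gsym : symmetric G) (Girr : irreflexive G),
      ~ (exists x y : 'I_t -> V,
           is_matching G x y /\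
           (\bigcap_(i in [set: 'I_t]) box (val (x i)) (val (y i)) !=set0)%classic) ->
      #|edges G|%:R <= c * t%:R * #|` V|%:R * ln (#|` V|%:R) ^+ (d - 1).
Proof.
case: d hd => // d _; have ln2 : 0 < ln 2 :> R by rewrite ln_gt0 // ltr1n.
(* From here [d] is the dimension minus one; each of the [d] logarithmic factors costs
   [3 / ln 2]. *)
exists (2 * (3 / ln 2) ^+ d); split.
  by rewrite mulr_gt0 // exprn_gt0 // divr_gt0.
move=> t _ V G Gsym Girr noM; rewrite subn1 /=.
(* An arbitrary enumeration of [V] orients each edge in exactly one way. *)
pose E := [set p : V * V | G p.1 p.2 && (enum_rank p.1 < enum_rank p.2)%N]%SET.
have edgesE : (#|edges G| <= #|E|)%N.
  apply: leq_trans (leq_imset_card (fun p : V * V => [set p.1; p.2]%SET) E).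
  apply/subset_leq_card/fintype.subsetP => A; rewrite inE.
  move=> /existsP[x /existsP[y /andP[Gxy /eqP->]]].
  case: (ltngtP (enum_rank x) (enum_rank y)) => [xy|yx|/val_inj/enum_rank_inj exy].
  - by apply/imsetP; exists (x, y); rewrite ?inE /= ?Gxy.
  - by apply/imsetP; exists (y, x); rewrite ?inE /= 1?Gsym ?Gxy // finset.setUC.
  - by rewrite exy Girr in Gxy.
pose X (i : nat) (v : V) : R := val v 0 (inord i).
have EM (M : {set V * V}) : M \subset E -> box_matching X d.+1 M -> (#|M| <= t)%N.
  (* The first [t] pairs of a larger [M] would form a forbidden matching. *)
  move=> ME [Mdis Mbox]; rewrite leqNgt; apply/negP => tM; apply: noM.
  have tM' := ltnW tM; pose m (i : 'I_t) := enum_val (widen_ord tM' i).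
  have mM i : m i \in M by apply: enum_valP.
  exists (fun i => (m i).1), (fun i => (m i).2); split; first split.
  - move=> i; have := fintype.subsetP ME _ (mM i); rewrite !inE => /andP[Gm _].
    by apply/existsP; exists (m i).1; apply/existsP; exists (m i).2; rewrite Gm /=.
  - move=> i j ij; apply: Mdis => //; apply: contra ij => /eqP/enum_val_inj.
    by move=> /(congr1 val) /= ij; apply/eqP/val_inj.
  - have /fin_all_exists[z zP] (i : 'I_d.+1) := Mbox i (ltn_ord i).
    exists (\row_i z i) => j _ i; rewrite mxE.
    by have := zP i _ (mM j); rewrite /X inord_val.
have EV p : p \in E -> [/\ p.1 \in [set: V]%SET, p.2 \in [set: V]%SET & (p.2, p.1) \notin E].
  by rewrite !inE => /andP[_ lt]; rewrite /= negb_and -leqNgt ltnW ?orbT.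
have cardV : #|[set: V]%SET| = #|` V| by rewrite cardsT cardfE.
(* The logarithmic estimate needs two vertices. With fewer there are no edges, and the right side is
   nonnegative, [ln 0] being 0 by convention. *)
have [V1|V1] := leqP #|` V| 1.
  have V1' : (#|[set: V]%SET| <= 2 ^ 0)%N by rewrite cardV.
  have E0 : #|E| = 0%N.
    apply: eq_card0 => p; apply/negP => pE; have [p1 p2 _] := EV _ pE.
    by move: pE; rewrite inE (card_le1_eqP V1' _ _ p1 p2) Girr.
  move: edgesE; rewrite E0 leqn0 => /eqP->.
  rewrite !mulr_ge0 ?exprn_ge0 ?divr_ge0 //; first exact: ltW.
  by case: #|` V| V1 => [|[|]] // _; rewrite ?ln1 ?ln0.
have VL : (#|[set: V]%SET| <= 2 ^ up_log 2 #|` V|)%N by rewrite cardV up_logP.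
have := leq_trans edgesE (box_edges_bound _ _ _ _ _ _ _ _ VL EV EM).
rewrite cardV -(ler_nat R) !natrM natrX => /le_trans; apply.
rewrite (_ : _ * ln _ ^+ d =
  2 * t%:R * #|` V|%:R * (3 / ln 2 * ln #|` V|%:R) ^+ d); last first.
  by rewrite [in RHS]exprMn; ring.
rewrite ler_wpM2l ?mulr_ge0 // lerXn2r ?nnegrE ?up_log_le_ln //.
by apply: le_trans (up_log_le_ln R _ V1).
Qed.
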